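(* Let $\beta>0$ and let $\psi:\mathbb{R}\to[0,\infty]$ be such that $e^{-\psi}$ is a distribution function on $\mathbb{R}$. Let $\{Y(t),t\ge0\}$ be a gamma-MID($\beta$) extremal process having homogeneous max-increments, i.e. $Y(1)$ has distribution function $\dfrac{1}{(1+\psi(x))^{\beta}}$, and let $\{T(t),t\ge0\}$ be an independent compounding process which is unit exponential, i.e. $T(1)$ has the exponential distribution with mean $1$. Then the extremal process $X(t)=Y(T(t))$ obtained by compounding is G-gamma-MID($\beta$), i.e. $X(1)$ has distribution function $\dfrac{1}{1+\beta\log(1+\psi(x))}$.
   Context: Conventions: $e^{-\infty}=0$, $1/\infty=0$, $\log\infty=\infty$. An extremal process (EP) is a process with increasing right-continuous sample paths and independent max-increments; its univariate marginals determine its finite-dimensional distributions. An EP $Y$ has homogeneous max-increments with distribution function $F$ if for each $t>0$ the variable $Y(t)$ has distribution function $F^{t}$. An EP is referred to by the name of the distribution of its (unit-time) max-increments, i.e. the law of its value at $t=1$. A compounding process for $Y$ is a non-negative process $\{T(t),t\ge0\}$, independent of $Y$, with stationary, independent, additive increments; it is referred to by the name of the law of $T(1)$. The compound (random time changed) EP is $X(t)=Y(T(t))$, which is again an EP. For $\beta>0$ and $\psi$ with $e^{-\psi}$ a distribution function, the gamma-MID($\beta$) law has distribution function $(1+\psi(x))^{-\beta}$ and the G-gamma-MID($\beta$) law has distribution function $\dfrac{1}{1+\beta\log(1+\psi(x))}$. *)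

(* Defs.v *)
From HB Require Import structures.
From mathcomp Require Import all_boot all_order all_algebra.
From mathcomp Require Import all_classical all_reals all_analysis.
From mathcomp Require Import measurable_realfun.

Set Implicit Arguments.
Unset Strict Implicit.
Unset Printing Implicit Defensive.

Import Order.TTheory GRing.Theory Num.Theory.
Import numFieldNormedType.Exports.

Local Open Scope classical_set_scope.
Local Open Scope ring_scope.

(* Processes are families of functions indexed by R, of which only the times
   t >= 0 are ever constrained or used.  Extremal processes take values in
   \bar R: if F is positive everywhere and Y(t) has distribution function F^t
   for every t > 0, then right-continuity forces Y(0) = -oo almost surely. *)

(* A proper distribution function on R, with values seen in \bar R. *)
Definition is_distribution_function (R : realType) (F : R -> \bar R) : Prop :=
  [/\ {homo F : x y / (x <= y)%R >-> (x <= y)%E},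
      right_continuous F,
      F x @[x --> -oo%R] --> 0%E &
      F x @[x --> +oo%R] --> 1%E].

Definition has_df d (T : measurableType d) (R : realType)
    (P : probability T R) (Z : T -> \bar R) (F : R -> \bar R) : Prop :=
  measurable_fun setT Z /\
  forall x : R, P [set w | (Z w <= x%:E)%E] = F x.

(* Taking A i = setT recovers the product rule for every subfamily. *)
Definition mutually_independent d (T : measurableType d) (R : realType)
    (P : probability T R) d' (T' : measurableType d') (n : nat)
    (Z : 'I_n -> T -> T') : Prop :=
  forall A : 'I_n -> set T', (forall i, measurable (A i)) ->
    P (\bigcap_(i in [set: 'I_n]) (Z i @^-1` A i)) =
    (\prod_(i < n) P (Z i @^-1` A i))%E.

Definition time_grid (R : realType) (n : nat) (t : 'I_n.+1 -> R) : Prop :=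
  0 <= t ord0 /\ {homo t : i j / (i < j)%N >-> i < j}.

(* For all times 0 <= t_0 < ... < t_n there are independent U_0, ..., U_n, on
   some probability space, such that (Y(t_0), ..., Y(t_n)) has the same law as
   (U_0, max(U_0, U_1), ..., max(U_0, ..., U_n)). *)
Definition independent_max_increments d (T : measurableType d) (R : realType)
    (P : probability T R) (Y : R -> T -> \bar R) : Prop :=
  forall (n : nat) (t : 'I_n.+1 -> R), time_grid t ->
  exists (d' : measure_display) (S : measurableType d') (Q : probability S R)
         (U : 'I_n.+1 -> S -> \bar R),
    [/\ forall i, measurable_fun setT (U i),
        mutually_independent Q U &
        forall A : 'I_n.+1 -> set (\bar R), (forall i, measurable (A i)) ->
          P (\bigcap_(i in [set: 'I_n.+1]) (Y (t i) @^-1` A i)) =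
          Q (\bigcap_(i in [set: 'I_n.+1])
               ((fun w => \big[maxe/-oo%E]_(j < n.+1 | (j <= i)%N) U j w)
                  @^-1` A i))].

Definition extremal_process d (T : measurableType d) (R : realType)
    (P : probability T R) (Y : R -> T -> \bar R) : Prop :=
  [/\ forall t : R, 0 <= t -> measurable_fun setT (Y t),
      forall w (s t : R), 0 <= s -> s <= t -> (Y s w <= Y t w)%E,
      forall w (t : R), 0 <= t -> Y s w @[s --> t^'+] --> Y t w &
      independent_max_increments P Y].

Definition homogeneous_max_increments d (T : measurableType d) (R : realType)
    (P : probability T R) (Y : R -> T -> \bar R) (F : R -> \bar R) : Prop :=
  forall t : R, 0 < t -> has_df P (Y t) (fun x => F x `^ t)%E.

Definition stationary_increments d (T : measurableType d) (R : realType)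
    (P : probability T R) (tau : R -> T -> R) : Prop :=
  forall (s h : R) (A : set R), 0 <= s -> 0 <= h -> measurable A ->
    P ((fun w => tau (s + h) w - tau s w) @^-1` A) =
    P ((fun w => tau h w - tau 0 w) @^-1` A).

Definition independent_increments d (T : measurableType d) (R : realType)
    (P : probability T R) (tau : R -> T -> R) : Prop :=
  forall (n : nat) (t : 'I_n.+1 -> R), time_grid t ->
    mutually_independent P
      (fun (i : 'I_n) w => tau (t (lift ord0 i)) w -
                           tau (t (widen_ord (leqnSn n) i)) w).

(* Independence of the sigma-algebras generated by (Y(t))_{t >= 0} and
   (tau(t))_{t >= 0}, on the generating finite-dimensional cylinders. *)
Definition independent_processes d (T : measurableType d) (R : realType)
    (P : probability T R) (Y : R -> T -> \bar R) (tau : R -> T -> R) : Prop :=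
  forall (m n : nat) (s : 'I_m -> R) (t : 'I_n -> R)
         (A : 'I_m -> set (\bar R)) (B : 'I_n -> set R),
    (forall i, 0 <= s i) -> (forall j, 0 <= t j) ->
    (forall i, measurable (A i)) -> (forall j, measurable (B j)) ->
    let EY := \bigcap_(i in [set: 'I_m]) (Y (s i) @^-1` A i) in
    let Etau := \bigcap_(j in [set: 'I_n]) (tau (t j) @^-1` B j) in
    P (EY `&` Etau) = (P EY * P Etau)%E.

Definition compounding_process d (T : measurableType d) (R : realType)
    (P : probability T R) (Y : R -> T -> \bar R) (tau : R -> T -> R) : Prop :=
  [/\ forall t : R, 0 <= t -> measurable_fun setT (tau t),
      forall (t : R) w, 0 <= t -> 0 <= tau t w,
      stationary_increments P tau,
      independent_increments P tau &
      independent_processes P Y tau].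

Definition unit_exponential d (T : measurableType d) (R : realType)
    (P : probability T R) (Z : T -> R) : Prop :=
  forall A : set R, measurable A -> P (Z @^-1` A) = exponential_prob 1 A.

Definition compound_process (T : Type) (R : realType)
    (Y : R -> T -> \bar R) (tau : R -> T -> R) : R -> T -> \bar R :=
  fun t w => Y (tau t w) w.

(* The extended-real conventions (+oo)^-1 = 0, expeR -oo = 0, lne +oo = +oo
   of the library are those wanted where psi x = +oo. *)
Definition gamma_mid_df (R : realType) (beta : R) (psi : R -> \bar R)
    (x : R) : \bar R :=
  (((1 + psi x) `^ beta)^-1)%E.

Definition G_gamma_mid_df (R : realType) (beta : R) (psi : R -> \bar R)
    (x : R) : \bar R :=
  ((1 + beta%:E * lne (1 + psi x))^-1)%E.

(* Main.v *)
Require Import Defs.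
From HB Require Import structures.
From mathcomp Require Import all_boot all_order all_algebra.
From mathcomp Require Import all_classical all_reals all_analysis.
From mathcomp Require Import measurable_realfun.
From mathcomp Require Import ring lra.

Set Implicit Arguments.
Unset Strict Implicit.
Unset Printing Implicit Defensive.

Import Order.TTheory GRing.Theory Num.Theory.
Import numFieldNormedType.Exports.

Local Open Scope classical_set_scope.
Local Open Scope ring_scope.
(** Fix [x] and let [F] be the value at [x] of the distribution function of
    [Y 1], so that [Y t <= x] has probability [F^t] for every [t > 0].  Since
    [Y] and [tau 1] are independent, conditioning on [tau 1] suggests
      [P (Y (tau 1) <= x) = \int_0^oo F^t e^-t dt = 1 / (1 - log F)],
    and [- log F = beta * log (1 + psi x)].

    The conditioning is replaced by a discretization.  For [h > 0], split the
    event [Y (tau 1) <= x] according to the cell [[kh, (k+1)h[] that contains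
    [tau 1] ([probability_grid]).  On that cell, monotonicity of the paths of
    [Y] gives
      [{Y ((k+1)h) <= x}] included in [{Y (tau 1) <= x}] included in
      [{Y (kh) <= x}],
    and the outer events involve a deterministic time, so that independence
    applies.  With [a = e^-h] and [q = F^h], the cell has probability
    [a^k (1 - a)], and summing geometric series gives ([compound_df_bounds])
      [q (1 - a) / (1 - a q) <= P (Y (tau 1) <= x) <= (1 - a) / (1 - a q)].
    Writing [F = e^-c], both bounds tend to [1 / (1 + c)] as [h] tends to [0]
    ([exponential_squeeze]); when [F = 0], which happens where [psi x = +oo],
    the upper bound [1 - a] already tends to [0] ([compound_df_zero]).

    Right-continuity of the paths serves only to show that [Y (tau 1)] is
    measurable ([measurable_fun_compound]). *)

(** * Exponential law and geometric series *)

Lemma exponential_prob_itvco (R : realType) (rate a b : R) : 0 <= a -> a < b ->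
  exponential_prob rate `[a, b[ =
    (expR (- rate * a) - expR (- rate * b))%:E.
Proof.
move=> a0 ab; rewrite /exponential_prob integral_itv_bndo_bndc; last first.
  apply/measurable_EFinP; apply: measurable_funTS.
  exact: measurable_exponential_pdf.
have cexp : continuous (fun z : R^o => expR (- rate * z)).
  move=> z; apply: continuous_comp; last exact: continuous_expR.
  by apply: continuousM => //; apply: (@continuousN _ R^o); exact: cst_continuous.
(* - expR (- rate * x) is an antiderivative of the density. *)
rewrite (@continuous_FTC2 _ _ (fun x => - expR (- rate * x))) //.
- by rewrite -EFinB opprK addrC.
- apply: (@continuous_subspaceW R^o _ _ [set` `[0, +oo[%R]).
    by move=> z /=; rewrite !in_itv/= andbT => /andP[/(le_trans a0)].
  exact: within_continuous_exponential_pdf.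
- split.
  + by move=> z _; exact: ex_derive.
  + by apply/cvg_at_right_filter; apply: cvgN; exact: cexp.
  + by apply/cvg_at_left_filter; apply: cvgN; exact: cexp.
- move=> z; rewrite in_itv/= => /andP[az _].
  by apply: derive1_exponential_pdf; rewrite in_itv/= andbT (le_lt_trans a0).
Qed.

Lemma nneseries_geometric (R : realType) (c z : R) : `|z| < 1 ->
  (\sum_(k <oo) (c * z ^+ k)%:E)%E = (c / (1 - z))%:E.
Proof.
move=> z1; apply: cvg_lim => //.
under eq_fun do rewrite sumEFin.
apply: cvg_EFin; first by near=> n.
exact: cvg_geometric_series.
Unshelve. all: by end_near. Qed.
(** * Random time change *)

(** Monotonicity and right-continuity of the paths make [Y (sigma w) w < y]
    equivalent to the existence of a rational time [q > sigma w] such that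
    [Y q w < y], which leaves a countable union of measurable events. *)
Lemma measurable_fun_compound d (T : measurableType d) (R : realType)
    (Y : R -> T -> \bar R) (sigma : T -> R) :
  (forall t, 0 <= t -> measurable_fun setT (Y t)) ->
  (forall w s t, 0 <= s -> s <= t -> (Y s w <= Y t w)%E) ->
  (forall w t, 0 <= t -> Y s w @[s --> t^'+] --> Y t w) ->
  measurable_fun setT sigma -> (forall w, 0 <= sigma w) ->
  measurable_fun setT (fun w => Y (sigma w) w).
Proof.
move=> mY ndY rcY msig sig0 mT.
apply: (measurability _ (ErealGenInftyO.measurableE R)) => //.
move=> /= _ [_ [y ->] <-]; rewrite preimage_itvNyo setTI.
rewrite [X in measurable X](_ : _ = \bigcup_(q : rat)
  ([set w | sigma w < ratr q] `&` [set w | 0 <= ratr q :> R /\ (Y (ratr q) w < y%:E)%E])).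
  apply: bigcupT_measurable_rat => q; apply: measurableI.
    by rewrite -preimage_itvNyo -[X in measurable X]setTI; exact: msig.
  have [q0|q0] := leP 0 (ratr q : R); last first.
    rewrite [X in measurable X](_ : _ = set0)//.
    by apply/seteqP; split => w //= -[].
  rewrite [X in measurable X](_ : _ = [set w | (Y (ratr q) w < y%:E)%E]).
    rewrite -[X in measurable X]setTI; apply: emeasurable_fun_infty_o => //.
    exact: mY.
  by apply/seteqP; split => w /= [].
apply/seteqP; split => w /= => [Yw|[q _ [/= sq [q0 Yq]]]].
- have : \forall s \near (sigma w)^'+, (Y s w < y%:E)%E.
    apply: (rcY w _ (sig0 w) [set z | (z < y%:E)%E]).
    apply: open_nbhs_nbhs; split => //.
    exact: open_ereal_lt_ereal.
  move=> [e /= e0 He].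
  have /rat_in_itvoo[q] : sigma w < sigma w + e by rewrite ltrDl.
  rewrite in_itv/= => /andP[sq qe].
  exists q => //; split => //=; split; first by rewrite (le_trans (sig0 w))// ltW.
  apply: He => //=.
  by rewrite distrC ger0_norm ?subr_ge0 ?ltW// ltrBlDl.
- by apply: le_lt_trans Yq; apply: ndY => //; exact: ltW.
Qed.

(** The case of one time for each process. *)
Lemma independent_processes_pair d (T : measurableType d) (R : realType)
    (P : probability T R) (Y : R -> T -> \bar R) (tau : R -> T -> R)
    (s t : R) (A : set (\bar R)) (B : set R) :
  independent_processes P Y tau -> 0 <= s -> 0 <= t ->
  measurable A -> measurable B ->
  P (Y s @^-1` A `&` tau t @^-1` B) = (P (Y s @^-1` A) * P (tau t @^-1` B))%E.
Proof.
move=> ind s0 t0 mA mB.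
have := ind 1%N 1%N (fun=> s) (fun=> t) (fun=> A) (fun=> B)
  (fun=> s0) (fun=> t0) (fun=> mA) (fun=> mB).
have cap1 (C : set T) : \bigcap_(i in [set: 'I_1]) C = C.
  by apply/seteqP; split => [w /(_ ord0 I)//|w Cw i].
by rewrite /= !cap1.
Qed.

(** Law of total probability for the partition of the half-line into the cells
    [[kh, (k+1)h[]. *)
Lemma probability_grid d (T : measurableType d) (R : realType)
    (P : probability T R) (sigma : T -> R) (h : R) (E : set T) :
  measurable_fun setT sigma -> (forall w, 0 <= sigma w) -> 0 < h ->
  measurable E ->
  P E = (\sum_(k <oo) P (E `&` (sigma @^-1` `[k%:R * h, k.+1%:R * h[)%R))%E.
Proof.
move=> msig sig0 h0 mE.
rewrite -measure_semi_bigcup.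
- congr (P _); apply/seteqP; split => [w Ew|w [k _ []//]].
  exists (Num.trunc (sigma w / h)) => //; split => //=.
  rewrite in_itv/= -ler_pdivlMr// -ltr_pdivrMr//.
  by apply: truncn_itv; rewrite divr_ge0// ltW.
- move=> k; apply: measurableI => //; rewrite -[X in measurable X]setTI.
  exact: msig.
- move=> i j _ _ [w [[_ /=]]]; rewrite !in_itv/= => /andP[i1 i2] [_ /andP[j1 j2]].
  have := le_lt_trans i1 j2; have := le_lt_trans j1 i2.
  rewrite !ltr_pM2r// !ltr_nat !ltnS => ji ij.
  by apply/eqP; rewrite eqn_leq ij ji.
- apply: bigcup_measurable => k _; apply: measurableI => //.
  by rewrite -[X in measurable X]setTI; exact: msig.
Qed.

(** The bounds are those of [compound_df_bounds] for [F = expR (- c)].  Both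
    are within [h] of [(1 + c)^-1], as follows from the elementary inequalities
    [x / (1 + x) <= 1 - expR (- x) <= x]. *)
Lemma exponential_squeeze (R : realType) (c p : R) : 0 <= c ->
  (forall h, 0 < h ->
     expR (- h * c) * (1 - expR (- h)) / (1 - expR (- h) * expR (- h * c)) <= p /\
     p <= (1 - expR (- h)) / (1 - expR (- h) * expR (- h * c))) ->
  p = (1 + c)^-1.
Proof.
move=> c0 H.
have lin (x : R) : 0 < x -> x / (1 + x) <= 1 - expR (- x) <= x.
  move=> x0; apply/andP; split; last first.
    by have := expR_ge1Dx (- x); lra.
  have x1 : 0 < 1 + x by lra.
  rewrite ler_pdivrMr// expRN mulrBl mul1r.
  suff : (expR x)^-1 * (1 + x) <= 1 by lra.
  by rewrite mulrC ler_pdivrMr ?expR_gt0// mul1r expR_ge1Dx.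
have c1 : 0 < 1 + c by lra.
apply/eqP; rewrite eq_le; apply/andP; split; apply/ler_addgt0Pr => h h0;
  have [lo up] := H h h0; have ch0 : 0 < h * (1 + c) by rewrite mulr_gt0.
- apply: (le_trans up); rewrite -expRD.
  have -> : - h + - h * c = - (h * (1 + c)) by ring.
  have /andP[_ e1] := lin _ h0; have /andP[e2 _] := lin _ ch0.
  have e3 : 0 < h * (1 + c) / (1 + h * (1 + c)) by rewrite divr_gt0//; lra.
  rewrite ler_pdivrMr ?(lt_le_trans e3)//; apply: (le_trans e1).
  apply: (@le_trans _ _ (((1 + c)^-1 + h) * (h * (1 + c) / (1 + h * (1 + c))))).
    rewrite le_eqVlt; apply/orP; left; apply/eqP; field.
    by rewrite !gt_eqF//; lra.
  by apply: ler_wpM2l => //; rewrite addr_ge0// ?invr_ge0 ltW.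
- apply: (@le_trans _ _ (expR (- h * c) * (1 - expR (- h)) /
      (1 - expR (- h) * expR (- h * c)) + h)); last by rewrite lerD2r.
  rewrite -expRD.
  have -> : - h + - h * c = - (h * (1 + c)) by ring.
  have /andP[e1 e1'] := lin _ h0; have /andP[e2 e2'] := lin _ ch0.
  have e3 : 0 < h * (1 + c) / (1 + h * (1 + c)) by rewrite divr_gt0//; lra.
  have d0 := lt_le_trans e3 e2.
  set D := 1 - expR _ in d0 e2' e2 *.
  (* For large h the target (1 + c)^-1 - h is nonpositive and the bound trivial. *)
  have [hb|hb] := leP (1 + c)^-1 h.
    rewrite (le_trans hb)// lerDr divr_ge0 ?(ltW d0)// mulr_ge0 ?expR_ge0//.
    by apply: le_trans e1; rewrite divr_ge0//; lra.
  rewrite -lerBlDr ler_pdivlMr//.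
  apply: (@le_trans _ _ (((1 + c)^-1 - h) * (h * (1 + c)))).
    by rewrite ler_wpM2l// subr_ge0 ltW.
  have -> : ((1 + c)^-1 - h) * (h * (1 + c)) = h * (1 - h * (1 + c)).
    by field; rewrite gt_eqF.
  have e5 : 1 - h * c <= expR (- h * c) by have := expR_ge1Dx (- h * c); lra.
  apply: (@le_trans _ _ (expR (- h * c) * (h / (1 + h)))); last first.
    by rewrite ler_wpM2l ?expR_ge0.
  apply: (@le_trans _ _ ((1 - h * c) * (h / (1 + h)))); last first.
    by rewrite ler_wpM2r// divr_ge0//; lra.
  rewrite mulrA ler_pdivlMr; last lra.
  rewrite -subr_ge0.
  have -> : (1 - h * c) * h - h * (1 - h * (1 + c)) * (1 + h) = h^+3 * (1 + c) by ring.
  by rewrite mulr_ge0 ?exprn_ge0// ltW.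
Qed.

(** * Distribution function of the compound process *)

(** Here [f] is the probability that [Y 1 <= x]; the value [f = 0] is allowed,
    and then [q = 0]. *)
Lemma compound_df_bounds d (T : measurableType d) (R : realType)
    (P : probability T R) (Y : R -> T -> \bar R) (tau : R -> T -> R)
    (x f h : R) :
  extremal_process P Y -> compounding_process P Y tau ->
  unit_exponential P (tau 1) -> 0 <= f <= 1 ->
  (forall t, 0 < t -> P [set w | (Y t w <= x%:E)%E] = (f `^ t)%:E) ->
  0 < h ->
  let q := f `^ h in
  let p := P [set w | (compound_process Y tau 1 w <= x%:E)%E] in
  ((q * (1 - expR (- h)) / (1 - expR (- h) * q))%:E <= p /\
   p <= ((1 - expR (- h)) / (1 - expR (- h) * q))%:E)%E.
Proof.
move=> [mY ndY rcY _] [mtau tau0 _ _ ind] Etau /andP[f0 f1] Yf h0 q p.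
have mt1 := mtau 1 ler01; have t1_0 w : 0 <= tau 1 w by exact: tau0.
have q0 : 0 <= q by exact: powR_ge0.
have q1 : q <= 1.
  by apply: le_trans (ge0_ler_powR (ltW h0) _ _ f1) _; rewrite ?nnegrE ?powR1.
pose a := expR (- h).
have a0 : 0 < a by exact: expR_gt0.
have a1 : a < 1 by rewrite -expR0 ltr_expR oppr_lt0.
have aq1 : `|a * q| < 1.
  rewrite ger0_norm; last by rewrite mulr_ge0// ltW.
  by rewrite (le_lt_trans _ a1)// ler_piMr// ltW.
have fq k : f `^ (k%:R * h) = q ^+ k by rewrite mulrC powRrM powR_mulrn.
pose E := [set w | (compound_process Y tau 1 w <= x%:E)%E].
pose L t := [set w | (Y t w <= x%:E)%E].
pose D (k : nat) := tau 1 @^-1` `[k%:R * h, k.+1%:R * h[.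
have k0 (k : nat) : 0 <= k%:R * h by rewrite mulr_ge0// ltW.
have mE : measurable E.
  rewrite -[E]setTI; apply: emeasurable_fun_infty_c => //.
  by apply: measurable_fun_compound => // t w t0; exact: ndY.
have mL t : 0 <= t -> measurable (L t).
  move=> t0; rewrite -[L t]setTI; apply: emeasurable_fun_infty_c => //.
  exact: mY.
have mD k : measurable (D k) by rewrite -[D k]setTI; exact: mt1.
have PD k : P (D k) = (a ^+ k * (1 - a))%:E.
  rewrite Etau// exponential_prob_itvco// ?ltr_pM2r ?ltr_nat//.
  have aX n : expR (-1 * (n%:R * h)) = a ^+ n.
    by rewrite -expRM_natl; congr expR; ring.
  by rewrite !aX exprS; congr EFin; ring.
have PLD t k : 0 <= t -> P (L t `&` D k) = (P (L t) * P (D k))%E.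
  move=> t0; have -> : L t = Y t @^-1` `]-oo, x%:E] by rewrite preimage_itvNyc.
  apply: independent_processes_pair => //; exact: emeasurable_itv.
rewrite {}/p -/E (probability_grid P mt1 t1_0 h0 mE) -/a; split.
- rewrite -nneseries_geometric//; apply: lee_nneseries.
    move=> k _ _; rewrite lee_fin mulr_ge0 ?exprn_ge0//.
      by rewrite mulr_ge0// subr_ge0 ltW.
    by rewrite mulr_ge0// ltW.
  move=> k _.
  have -> : ((q * (1 - a) * (a * q) ^+ k)%:E =
      P (L (k.+1%:R * h)%R `&` D k))%E.
    rewrite PLD// PD Yf ?mulr_gt0// fq -EFinM exprMn exprS.
    by congr EFin; ring.
  apply: le_measure; rewrite ?inE.
  + by apply: measurableI => //; exact: mL.
  + by apply: measurableI => //; exact: mD.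
  + move=> w [/= Lw Dw]; split => //.
    apply: le_trans Lw; apply: ndY => //.
    by move: Dw; rewrite /D/= in_itv/= => /andP[_ /ltW].
- rewrite -nneseries_geometric//; apply: lee_nneseries => // k _.
  apply: (@le_trans _ _ (P (L (k%:R * h)%R `&` D k))).
    apply: le_measure; rewrite ?inE.
    + by apply: measurableI => //; exact: mD.
    + by apply: measurableI => //; exact: mL.
    + move=> w [/= Ew Dw]; split => //.
      apply: le_trans Ew; apply: ndY => //.
      by move: Dw; rewrite /D/= in_itv/= => /andP[].
  rewrite PLD// PD.
  apply: (@le_trans _ _ ((q ^+ k)%:E * (a ^+ k * (1 - a))%:E)%E).
    apply: lee_wpmul2r.
      by rewrite lee_fin mulr_ge0 ?exprn_ge0 ?subr_ge0 ?(ltW a0) ?(ltW a1).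
    (* Yf says nothing about time 0, but for k = 0 the bound on P (L 0) is 1. *)
    case: k => [|k]; first by rewrite expr0 probability_le1//; exact: mL.
    by rewrite Yf ?mulr_gt0// fq.
  by rewrite -EFinM lee_fin exprMn le_eqVlt; apply/orP; left; apply/eqP; ring.
Qed.

Lemma compound_df_expR d (T : measurableType d) (R : realType)
    (P : probability T R) (Y : R -> T -> \bar R) (tau : R -> T -> R)
    (x c : R) :
  extremal_process P Y -> compounding_process P Y tau ->
  unit_exponential P (tau 1) -> 0 <= c ->
  (forall t, 0 < t -> P [set w | (Y t w <= x%:E)%E] = (expR (- c) `^ t)%:E) ->
  P [set w | (compound_process Y tau 1 w <= x%:E)%E] = ((1 + c)^-1)%:E.
Proof.
move=> epY cpt ut c0 Yf.
have f01 : 0 <= expR (- c) <= 1 by rewrite expR_ge0 -expR0 ler_expR oppr_le0.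
have := compound_df_bounds epY cpt ut f01 Yf => /=.
set p := P _ => H.
have pfin : p \is a fin_num.
  have [p1 p2] := H 1 ltr01.
  by rewrite fin_numE gt_eqF ?lt_eqF// ?(le_lt_trans p2) ?(lt_le_trans _ p1) ?ltry ?ltNyr.
rewrite -(fineK pfin); congr EFin; apply: exponential_squeeze => // h h0.
have := H h h0; rewrite -(fineK pfin) !lee_fin -expRM.
by have -> : - c * h = - h * c by ring.
Qed.

Lemma compound_df_zero d (T : measurableType d) (R : realType)
    (P : probability T R) (Y : R -> T -> \bar R) (tau : R -> T -> R) (x : R) :
  extremal_process P Y -> compounding_process P Y tau ->
  unit_exponential P (tau 1) ->
  (forall t, 0 < t -> P [set w | (Y t w <= x%:E)%E] = 0%E) ->
  P [set w | (compound_process Y tau 1 w <= x%:E)%E] = 0%E.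
Proof.
move=> epY cpt ut Y0.
have Yf t : 0 < t -> P [set w | (Y t w <= x%:E)%E] = (0 `^ t)%:E.
  by move=> t0; rewrite Y0// powR0// gt_eqF.
have f01 : (0 : R) <= (0 : R) <= (1 : R) by rewrite lexx ler01.
apply/eqP; rewrite eq_le measure_ge0 andbT; apply/lee_addgt0Pr => h h0.
have [_ ub] := compound_df_bounds epY cpt ut f01 Yf h0.
rewrite add0e (le_trans ub)// lee_fin powR0 ?gt_eqF// mulr0 subr0 divr1.
by have := expR_ge1Dx (- h); lra.
Qed.

Theorem theorem3p1 (R : realType) (d : measure_display)
    (Omega : measurableType d) (P : probability Omega R)
    (beta : R) (psi : R -> \bar R)
    (Y : R -> Omega -> \bar R) (tau : R -> Omega -> R) :
  0 < beta ->
  (forall x, (0 <= psi x)%E) ->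
  is_distribution_function (fun x => expeR (- psi x)%E) ->
  extremal_process P Y ->
  homogeneous_max_increments P Y (gamma_mid_df beta psi) ->
  compounding_process P Y tau ->
  unit_exponential P (tau 1) ->
  has_df P (compound_process Y tau 1) (G_gamma_mid_df beta psi).
Proof.
move=> beta0 psi0 _ epY hY cpt ut; split.
  have [mY ndY rcY _] := epY; have [mtau tau0 _ _ _] := cpt.
  by apply: measurable_fun_compound => //; [exact: mtau | move=> w; exact: tau0].
move=> x; rewrite /G_gamma_mid_df.
have Yx t : 0 < t -> P [set w | (Y t w <= x%:E)%E] = (gamma_mid_df beta psi x `^ t)%E.
  by move=> /hY [_]; exact.
rewrite /gamma_mid_df in Yx.
case: (psi x) (psi0 x) Yx => [r r0|_|//] Yx.
- have r1 : 0 < 1 + r by rewrite ltr_pwDl// ltr01.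
  rewrite -EFinD lne_EFin// -EFinM -EFinD inver ifF; last first.
    by rewrite gt_eqF// ltr_pwDl// mulr_ge0 ?(ltW beta0)// ln_ge0// lerDl.
  apply: compound_df_expR => // [|t t0].
    by rewrite mulr_ge0 ?(ltW beta0)// ln_ge0// lerDl.
  rewrite Yx// -EFinD poweR_EFin inver gt_eqF ?powR_gt0// poweR_EFin.
  by rewrite expRN /powR (gt_eqF r1).
- rewrite addey//= gt0_muley ?lte_fin// addey// invey.
  apply: compound_df_zero epY cpt ut _ => t t0.
  by rewrite Yx// addey// poweRyr ?gt_eqF// invey poweR0r// gt_eqF.
Qed.
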